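(* Let $t$ be a positive integer and let $G$ be a connected simple graph of order $n\geq 7t+2$ with minimum degree $\delta(G)\geq t$. If $\mu(G)\leq \mu\big(K_t\vee(K_{n-2t}\cup tK_1)\big)$, then $G$ has a spanning tree with leaf distance at least four.
   Context: For a connected graph $G$ with vertices $v_1,\dots,v_n$, the distance matrix $\mathcal{D}(G)$ is the $n\times n$ matrix whose $(i,j)$-entry is the distance between $v_i$ and $v_j$ in $G$; $\mu(G)$ denotes the largest eigenvalue of $\mathcal{D}(G)$. $K_m$ is the complete graph on $m$ vertices, $tK_1$ is the graph of $t$ isolated vertices, $G_1\cup G_2$ is the vertex-disjoint union, and $G_1\vee G_2$ (join) is obtained from $G_1\cup G_2$ by adding all edges between $V(G_1)$ and $V(G_2)$. A leaf of a tree is a vertex of degree one; the leaf distance of a tree is the minimum distance in the tree between two distinct leaves. *)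

(* Defs.v *)
From HB Require Import structures.
From mathcomp Require Import all_boot all_order all_algebra.
From mathcomp Require Import classical_sets reals.

Set Implicit Arguments.
Unset Strict Implicit.
Unset Printing Implicit Defensive.

Import Order.TTheory GRing.Theory Num.Theory.

(* A graph on a finite vertex type is given by its adjacency relation. *)

Definition simple_graph (V : finType) (e : rel V) : Prop :=
  symmetric e /\ irreflexive e.

Definition connected_graph (V : finType) (e : rel V) : Prop :=
  forall x y : V, connect e x y.

Definition deg (V : finType) (e : rel V) (x : V) : nat := #|[set y | e x y]|.

(* In a nonempty simple graph every degree is less than #|V|, so the initial
   value does not affect the minimum. *)
Definition min_degree (V : finType) (e : rel V) : nat :=
  \big[minn/#|V|]_(x : V) deg e x.

(* The least length k < #|V| of a walk from x to y; the value is #|V| when y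
   is not reachable from x. *)
Definition gdist (V : finType) (e : rel V) (x y : V) : nat :=
  find (fun k => [exists p : k.-tuple V, path e x p && (last x p == y)])
       (iota 0 #|V|).

Definition distance_matrix (R : nzRingType) (V : finType) (e : rel V) :
    'M[R]_#|V| :=
  \matrix_(i, j) (gdist e (enum_val i) (enum_val j))%:R%R.

(* The set of eigenvalues of a matrix is finite, and it is nonempty for the
   symmetric matrix of a nonempty simple graph, so this supremum is then
   the largest eigenvalue. *)
Definition mu (R : realType) (V : finType) (e : rel V) : R :=
  sup [set a : R | eigenvalue (distance_matrix R e) a]%classic.

Definition complete_graph (m : nat) : rel 'I_m := fun x y => x != y.
Arguments complete_graph m : clear implicits.

Definition edgeless_graph (m : nat) : rel 'I_m := fun _ _ => false.
Arguments edgeless_graph m : clear implicits.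

Definition disjoint_union (V W : finType) (e : rel V) (f : rel W) :
    rel (V + W)%type :=
  fun u v => match u, v with
             | inl x, inl y => e x y
             | inr x, inr y => f x y
             | _, _ => false
             end.

Definition graph_join (V W : finType) (e : rel V) (f : rel W) :
    rel (V + W)%type :=
  fun u v => match u, v with
             | inl x, inl y => e x y
             | inr x, inr y => f x y
             | _, _ => true
             end.

(* ucycle also holds of sequences of length at most 2 that are not cycles of
   the graph, such as [:: x; y] for an edge xy. *)
Definition acyclic (V : finType) (e : rel V) : Prop :=
  forall c : seq V, 2 < size c -> ~ ucycle e c.

Definition tree (V : finType) (e : rel V) : Prop :=
  [/\ simple_graph e, connected_graph e & acyclic e].

Definition spanning_tree (V : finType) (e f : rel V) : Prop :=
  tree f /\ subrel f e.

Definition leaf (V : finType) (f : rel V) (x : V) : bool := deg f x == 1.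

(* In a connected graph every distance is less than #|V|, so the initial value
   matters only when there are no two distinct leaves, which for a tree means
   a single vertex. *)
Definition leaf_distance (V : finType) (f : rel V) : nat :=
  \big[minn/#|V|]_(p : V * V | [&& leaf f p.1, leaf f p.2 & p.1 != p.2])
    gdist f p.1 p.2.

(* Main.v *)
Require Import Defs.
From HB Require Import structures.
From mathcomp Require Import all_boot all_order all_algebra.
From mathcomp Require Import boolp classical_sets reals.
From mathcomp Require Import sesquilinear spectral complex.
From mathcomp Require Import zify ring lra.

(* The graph [e] even has a Hamiltonian path, and a Hamiltonian path is a
   spanning tree whose two leaves are at distance [n - 1].

   Suppose it has none, and add edges between nonadjacent vertices of degree sum
   at least [n - 1] as long as possible. By Ore's rotation argument the result
   [h] still has no Hamiltonian path. Let [C] be a maximal clique of [h]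
   containing all vertices of degree at least [(n - 1) / 2], [W] its complement
   and [k = #|W|]. Saturation gives [k > t], every vertex of [W] has degree at
   most [k - 1], and a vertex of [C] not adjacent to all of [W] has at most
   [k - 1 - t] neighbours there.

   Let [u - 1] be the largest distance eigenvalue of the extremal graph and
   [(a, 1, c)] the values of its Perron vector on [K_t], [K_(n-2t)] and [t K_1].
   If [2 k < n], the Rayleigh quotient of the vector equal to [c] on [W], to [a]
   on the vertices of [C] adjacent to all of [W] and to [1] elsewhere shows that
   the largest distance eigenvalue of [e] exceeds [u - 1]. If [2 k >= n], the
   vector equal to [3/2] on [W] and to [1] on [C] does. *)

Set Implicit Arguments.
Unset Strict Implicit.
Unset Printing Implicit Defensive.

Import Order.TTheory GRing.Theory Num.Theory.

(** * Distance eigenvalues *)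

Section SymmetricForms.
Local Open Scope ring_scope.
Local Open Scope sesquilinear_scope.

(** Over [R[i]] the matrix is Hermitian, hence [P^* diag(d) P] with [P] unitary and [d] real. Each
    [d_i] is an eigenvalue of [A], and with [z = x P^*] the difference of the two sides is the sum
    of the [(b - d_i) |z_i|^2]. *)
Lemma symmetric_form_le (R : rcfType) n (A : 'M[R]_n) (b : R) (x : 'rV[R]_n) :
    A^T = A -> (forall a, eigenvalue A a -> a <= b) ->
  (x *m A *m x^T) 0 0 <= b * (x *m x^T) 0 0.
Proof.
move=> Asym eig_le; pose f := real_complex R.
have freal r : f r \is Num.real by apply/complex_realP; exists r.
have Aherm : map_mx f A \is hermsymmx.
  apply: realsym_hermsym; last by apply/mxOverP => i j; rewrite mxE.
  rewrite qualifE /= expr0 scale1r map_mx_id // map_trmx Asym. done.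
have /orthomx_spectralP := hermitian_normalmx Aherm.
have /mxOverP := hermitian_spectral_diag_real Aherm.
have := spectral_unitarymx (map_mx f A).
move: (spectralmx _) (spectral_diag _) => P d Pu dreal; rewrite invmx_unitary // => AE.
have PPt : P *m P ^t* = 1%:M by apply/unitarymxP.
have PtP : P ^t* *m P = 1%:M by apply: mulmx1C.
have d_le i : d 0 i <= f b.
  have /complex_realP [r dr] := dreal 0 i.
  rewrite dr lecR; apply: eig_le.
  (* Being an eigenvalue descends from [R[i]] to [R] because it is a root condition on the
     characteristic polynomial. *)
  rewrite eigenvalue_root_char -(fmorph_root f) map_char_poly -eigenvalue_root_char.
  apply/eigenvalueP; exists (row i P).
    rewrite AE -row_mul !mulmxA PPt mul1mx row_mul row_diag_mx -scalemxAl -rowE.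
    by rewrite dr.
  apply: contraTneq isT => /(congr1 (mulmx^~ (P ^t*))).
  rewrite -row_mul PPt mul0mx => /rowP/(_ i).
  by rewrite !mxE eqxx => /eqP; rewrite oner_eq0.
pose z := map_mx f x *m P ^t*.
have zt : z ^t* = P *m map_mx f x^T.
  rewrite /z trmx_mul map_mxM /= !map_trmx trmxK; congr (_ *m _);
    apply/matrixP => i j; rewrite !mxE /=.
    by rewrite conjCK.
  by apply/CrealP.
rewrite -subr_ge0 -(lecR 0).
have -> : (b * (x *m x^T) 0 0 - (x *m A *m x^T) 0 0)%:C%C
  = (z *m diag_mx (const_mx (f b) - d) *m z ^t*) 0 0.
  rewrite zt rmorphB rmorphM /=.
  have mapE (B : 'M[R]_1) : (B 0 0)%:C%C = (map_mx f B) 0 0 by rewrite mxE.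
  rewrite !mapE !map_mxM AE /z [diag_mx (_ - _)]raddfB mulmxBr mulmxBl /= diag_const_mx.
  rewrite !mulmxA mul_mx_scalar -!scalemxAl -[_ *m P *m _]mulmxA -(mulmxA _ _ P).
  by rewrite PtP !mulmxA mulmx1 [RHS]mxE [X in _ = X + _]mxE [X in _ = _ + X]mxE.
move: z {zt} => z; rewrite mul_mx_diag mxE; apply: sumr_ge0 => i _.
rewrite !mxE mulrAC mulr_ge0 ?subr_ge0 //.
by rewrite -normCK exprn_ge0.
Qed.

End SymmetricForms.

(** * Distances as lengths of shortest walks *)

Section GraphDistance.
Variables (V : finType) (e : rel V).

(** The bound [l <= #|V|] covers the case that no walk reaches [y], where [gdist] is [#|V|]. *)
Lemma gdist_ge x y l : l <= #|V| ->
    (forall p, path e x p -> last x p = y -> l <= size p) ->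
  l <= gdist e x y.
Proof.
move=> lV walk_ge; rewrite /gdist; set P := (fun k => _).
rewrite leqNgt; apply/negP => find_lt.
have hasP : has P (iota 0 #|V|).
  by rewrite has_find size_iota (leq_trans find_lt).
have := nth_find 0 hasP; rewrite nth_iota; last first.
  by rewrite -[X in _ < X](size_iota 0) -has_find.
rewrite add0n => /existsP [p /andP [ep /eqP lp]].
have := walk_ge _ ep lp; rewrite size_tuple leqNgt => /negP; apply.
exact: find_lt.
Qed.

Lemma gdist_le x (p : seq V) : path e x p -> size p < #|V| ->
  gdist e x (last x p) <= size p.
Proof.
move=> ep pV; rewrite /gdist; set P := (fun k => _); rewrite leqNgt.
apply/negP => /(before_find 0); rewrite nth_iota // add0n => /negbT/negP; apply.
by apply/existsP; exists (in_tuple p); rewrite ep eqxx.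
Qed.

Lemma gdist_refl x : gdist e x x = 0.
Proof.
apply/eqP; rewrite -leqn0; apply: (@gdist_le x [::]) => //=.
by apply/card_gt0P; exists x.
Qed.

Lemma gdist_sym : symmetric e -> forall x y, gdist e x y = gdist e y x.
Proof.
move=> esym x y; rewrite /gdist; apply: eq_find => k /=.
have walk_rev (u v : V) (p : k.-tuple V) : path e u p -> last u p = v ->
    [exists q : k.-tuple V, path e v q && (last v q == u)].
  move=> ep lp; have sz : size (rev (belast u p)) == k.
    by rewrite size_rev size_belast size_tuple.
  apply/existsP; exists (Tuple sz); rewrite /= -lp.
  rewrite rev_path.
  rewrite (eq_path (e' := e)) => [|z w]; last by rewrite /= esym.
  rewrite ep /=; case: (p : seq V) => [|z q] //=.
  by rewrite rev_cons last_rcons.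
apply/idP/idP => /existsP [p /andP [ep /eqP lp]]; exact: walk_rev ep lp.
Qed.

Lemma gdist_gt0 x y : x != y -> 0 < gdist e x y.
Proof.
move=> xy; apply: gdist_ge => [|[|z p] //= _ xy0].
  by apply/card_gt0P; exists x.
by rewrite xy0 eqxx in xy.
Qed.

Lemma gdist_gt1 x y : x != y -> ~~ e x y -> 1 < gdist e x y.
Proof.
move=> xy exy; apply: gdist_ge => [|[|z [|w p]] //=].
- by rewrite (cardD1 x) (cardD1 y) !inE eq_sym xy.
- by move=> _ xy0; rewrite xy0 eqxx in xy.
- by rewrite andbT => exz zy; rewrite -zy exz in exy.
Qed.

Lemma gdist_adj x y : e x y -> x != y -> gdist e x y <= 1.
Proof.
move=> exy xy; apply: (@gdist_le x [:: y]); rewrite /= ?exy //.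
by rewrite (cardD1 x) (cardD1 y) !inE eq_sym xy.
Qed.

Lemma gdist_common x y z : e x z -> e z y -> 2 < #|V| -> gdist e x y <= 2.
Proof.
by move=> exz ezy V3; apply: (@gdist_le x [:: z; y]); rewrite /= ?exz ?ezy.
Qed.

End GraphDistance.

(** * Upper and lower bounds for the largest distance eigenvalue *)

Section LargestEigenvalue.
Local Open Scope ring_scope.
Variables (R : realType) (V : finType) (e : rel V).

(* Compare the eigenvector with [y] at an index where their ratio is largest. *)
Lemma distance_eigenvalue_le (y : V -> R) (l : R) :
    (forall x, 0 < y x) ->
    (forall x, \sum_z y z * (gdist e z x)%:R <= l * y x) ->
  forall a, eigenvalue (distance_matrix R e) a -> a <= l.
Proof.
move=> y_gt0 yl a /eigenvalueP [v va v0].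
pose r x := `|v 0 (enum_rank x)| / y x.
have [i vi0] : exists i, v 0 i != 0.
  by apply/existsP; rewrite -negb_forall; apply: contra v0 => /forallP v0;
    apply/eqP/rowP => i; rewrite mxE; apply/eqP.
pose x := [arg max_(x > enum_val i) r x]%O.
have rx z : r z <= r x by rewrite /x; case: arg_maxP => //= ? _; apply.
have rx_gt0 : 0 < r x.
  apply: lt_le_trans (rx (enum_val i)).
  by rewrite /r enum_valK divr_gt0 ?normr_gt0.
have vE z : `|v 0 (enum_rank z)| = r z * y z by rewrite divfK ?gt_eqF.
rewrite -(ler_pM2r rx_gt0) -(ler_pM2r (y_gt0 x)) -mulrA -vE.
apply: (@le_trans _ _ (`|a * v 0 (enum_rank x)|)).
  by rewrite normrM ler_wpM2r // ler_norm.
have -> : a * v 0 (enum_rank x) = \sum_z v 0 (enum_rank z) * (gdist e z x)%:R.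
  have /rowP/(_ (enum_rank x)) := va; rewrite !mxE => <-.
  rewrite (reindex (@enum_rank V)) /=; last first.
    by apply: onW_bij; apply: enum_rank_bij.
  by apply: eq_bigr => z _; rewrite !mxE !enum_rankK.
apply: (le_trans (ler_norm_sum _ _ _)).
rewrite mulrAC; apply: le_trans (ler_wpM2r (ltW rx_gt0) (yl x)).
rewrite mulr_suml; apply: ler_sum => z _.
rewrite normrM vE normr_nat -mulrA [X in _ <= X]mulrC ler_wpM2r //.
by rewrite mulr_ge0 ?ler0n // ltW.
Qed.

(** The hypothesis [0 <= l] covers an empty set of eigenvalues, whose [sup] is [0]. *)
Lemma mu_le (y : V -> R) (l : R) :
    0 <= l -> (forall x, 0 < y x) ->
    (forall x, \sum_z y z * (gdist e z x)%:R <= l * y x) ->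
  mu R e <= l.
Proof.
move=> l_ge0 y_gt0 yl; rewrite /mu; set E := [set a | _]%classic.
have El : ubound E l by move=> a /=; apply: distance_eigenvalue_le yl a.
have [->|/set0P E0] := eqVneq E set0; first by rewrite sup0.
exact: ge_sup.
Qed.

Lemma distance_form_le (f : V -> R) : symmetric e ->
  \sum_x \sum_z f x * f z * (gdist e x z)%:R <= mu R e * \sum_x f x ^+ 2.
Proof.
move=> esym.
have E_bound a : eigenvalue (distance_matrix R e) a -> a <= mu R e.
  move=> Ea; apply: ub_le_sup => //.
  (* The supremum needs some upper bound: the sum of all distances bounds every row sum, hence every
     eigenvalue by comparison with the all-ones vector. *)
  exists (\sum_x \sum_z (gdist e z x)%:R) => b /=.
  apply: (@distance_eigenvalue_le (fun=> 1)) => // x.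
  rewrite mulr1 [X in _ <= X](bigD1 x) //=.
  rewrite (eq_bigr (fun z => (gdist e z x)%:R)) => [|z _]; last by rewrite mul1r.
  by rewrite lerDl; do 2!(apply: sumr_ge0 => ? _).
have Dsym : (distance_matrix R e)^T = distance_matrix R e.
  by apply/matrixP => i j; rewrite !mxE gdist_sym.
pose x : 'rV[R]_#|V| := \row_i f (enum_val i).
have := symmetric_form_le x Dsym E_bound.
have rV_sum (F : 'I_#|V| -> R) : \sum_i F i = \sum_(z : V) F (enum_rank z).
  by rewrite (reindex (@enum_rank V)) //; apply/onW_bij/enum_rank_bij.
rewrite !mxE !rV_sum.
have -> : \sum_z x 0 (enum_rank z) * x^T (enum_rank z) 0 = \sum_z f z ^+ 2.
  by apply: eq_bigr => z _; rewrite !mxE enum_rankK.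
apply: le_trans; rewrite exchange_big /=; apply: ler_sum => z _.
rewrite !mxE rV_sum enum_rankK mulr_suml; apply: ler_sum => w _.
by rewrite !mxE !enum_rankK mulrAC.
Qed.

End LargestEigenvalue.

(** * Hamiltonian paths *)

Section HamiltonianPath.
Variables (V : finType) (e : rel V) (x : V) (p : seq V).
Hypotheses (e_simple : simple_graph e) (ep : path e x p).
Hypotheses (p_uniq : uniq (x :: p)) (p_all : forall v, v \in x :: p).
Hypothesis (V_gt4 : 4 < #|V|).

Let pos v := index v (x :: p).
Let succ v w := (pos v).+1 == pos w.
Let f : rel V := fun v w => succ v w || succ w v.

Let size_p : size (x :: p) = #|V|.
Proof. by rewrite -(card_uniqP p_uniq); apply: eq_card => v; rewrite p_all. Qed.

Let pos_lt v : pos v < #|V|.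
Proof. by rewrite -size_p index_mem. Qed.

Let pos_inj v w : pos v = pos w -> v = w.
Proof. by move=> vw; rewrite -(nth_index x (p_all v)) -/(pos v) vw nth_index. Qed.

Let pos_nth i : i < #|V| -> pos (nth x (x :: p) i) = i.
Proof. by move=> iV; rewrite /pos index_uniq // size_p. Qed.

Let succ_e v w : succ v w -> e v w.
Proof.
move=> /eqP vw; have vp : pos v < size p.
  by rewrite -ltnS -[X in _ < X]/(size (x :: p)) size_p vw pos_lt.
have := pathP x ep (pos v) vp.
by rewrite -[nth x p _]/(nth x (x :: p) (pos v).+1) vw !nth_index.
Qed.

Let f_sym : symmetric f.
Proof. by move=> v w; rewrite /f orbC. Qed.

Let f_connected : connected_graph f.
Proof.
have to_head v : connect f x v.
  move: {2}(pos v) (erefl (pos v)) => i; elim: i v => [|i IHi] v vi.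
    by rewrite (@pos_inj v x) // vi /pos /= eqxx.
  have iV : i < #|V| by have := pos_lt v; rewrite vi; apply: ltnW.
  apply: connect_trans (IHi _ (pos_nth iV)) (connect1 _).
  by rewrite /f /succ pos_nth // vi eqxx.
move=> v w; apply: connect_trans (to_head w).
by rewrite (sym_connect_sym f_sym); apply: to_head.
Qed.

(* The two neighbours in a cycle of its vertex of largest position would both
   be the predecessor of that vertex. *)
Let f_acyclic : acyclic f.
Proof.
move=> c c_gt2 /andP [fc c_uniq].
have [v vc v_max] : exists2 v, v \in c & forall w, w \in c -> pos w <= pos v.
  case: c c_gt2 {fc c_uniq} => // v0 c _.
  have v0c : v0 \in v0 :: c by rewrite inE eqxx.
  by case: (arg_maxnP pos v0c) => v vc v_max; exists v => // w /v_max.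
have [i c' rot_c] := rot_to vc.
move: fc c_uniq c_gt2; rewrite -(rot_cycle i) -(rot_uniq i) -(size_rot i) rot_c.
have c'_le w : w \in c' -> pos w <= pos v.
  by move=> wc; apply: v_max; rewrite -(mem_rot i) rot_c inE wc orbT.
have pred w : w \in c' -> f v w -> (pos w).+1 = pos v.
  by move=> /c'_le + /orP [] /eqP; lia.
case: c' {rot_c v_max} c'_le pred => // w c' _ pred.
rewrite /= rcons_path => /and3P [fvw _ fv] /and3P [_ w_uniq _].
have := pred (last w c'); rewrite mem_last f_sym fv => /(_ isT isT).
rewrite -(pred w) ?inE ?eqxx // => -[/pos_inj].
by case: c' w_uniq {fv pred} => //= u c' w_uniq lw; rewrite -lw mem_last in w_uniq.
Qed.

(** An inner vertex of the path has two different neighbours, at the positions before and after its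
    own. *)
Let leaf_end v : leaf f v -> (pos v == 0) || (pos v == #|V|.-1).
Proof.
move=> /cards1P [u fv]; apply/negPn; rewrite negb_or; apply/negP => /andP [v0 v1].
have u_nth i : i < #|V| -> (i.+1 == pos v) || ((pos v).+1 == i) ->
    nth x (x :: p) i = u.
  move=> iV iv; apply/set1P; rewrite -fv inE /f /succ pos_nth //.
  by rewrite orbC.
have pv := pos_lt v; have := congr1 pos (u_nth (pos v).-1 _ _).
rewrite -(u_nth (pos v).+1) ?eqxx ?orbT //; last by lia.
by rewrite !pos_nth; lia.
Qed.

(** Each edge of [f] changes the position by exactly one. *)
Let walk_pos v q : path f v q ->
  (pos v <= pos (last v q) + size q) && (pos (last v q) <= pos v + size q).
Proof.
elim: q v => [|w q IHq] v /=; first by rewrite addn0 leqnn.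
by case/andP => /orP [] /eqP vw /IHq; lia.
Qed.

Lemma hamiltonian_path_spanning_tree :
  exists g : rel V, spanning_tree e g /\ 4 <= leaf_distance g.
Proof.
exists f; split.
  split=> [|v w]; last first.
    by case/orP => /succ_e //; case: e_simple => /(_ v w) ->.
  split=> //; split=> // v; rewrite /f /succ orbb; lia.
rewrite /leaf_distance.
(* The initial value [#|V|] of the minimum is at least four as well. *)
elim/big_ind: _ => [|m1 m2|[v w] /and3P [/= fv fw vw]]; first exact: ltnW.
  by rewrite leq_min => -> ->.
apply: leq_trans (_ : #|V|.-1 <= _); first by lia.
apply: gdist_ge => [|q fq lq]; first by lia.
(* Distinct leaves sit at opposite ends, so a walk between them has at least [#|V|.-1] steps. *)
have := walk_pos fq; rewrite lq.
have {vw}: pos v <> pos w by move/pos_inj/eqP; apply/negP.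
by case/orP: (leaf_end fv) => /eqP ->; case/orP: (leaf_end fw) => /eqP ->; lia.
Qed.

End HamiltonianPath.

(** For any relation, transitive or not, [sorted] only asks that consecutive entries be related, so
    [s] is a Hamiltonian path. *)
Definition traceable (V : finType) (e : rel V) : Prop :=
  exists s : seq V, [/\ sorted e s, uniq s & forall v, v \in s].

Section Splitting.
Variables (T : eqType) (e : rel T).

Lemma sorted_cat_head x0 (s1 s2 : seq T) :
    sorted e s1 -> sorted e s2 -> e (last x0 s1) (head x0 s2) ->
  sorted e (s1 ++ s2).
Proof.
case: s1 s2 => [|x s1] [|y s2] //=; first by rewrite cats0.
by rewrite cat_path /= => -> -> ->.
Qed.

Lemma not_sorted_split (s : seq T) : ~~ sorted e s ->
  exists s1 x y s2, s = rcons s1 x ++ y :: s2 /\ ~~ e x y.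
Proof.
elim: s => [|x [|y s] IHs] //=; rewrite negb_and.
have [exy /= /IHs [s1 [a [b [s2 [-> ab]]]]]|nexy _] := boolP (e x y).
  by exists (x :: s1), a, b, s2.
by exists [::], x, y, s.
Qed.

Lemma last_rev x0 (s : seq T) : last x0 (rev s) = head x0 s.
Proof. by case: s => [|x s] //=; rewrite rev_cons last_rcons. Qed.

Lemma head_rev x0 (s : seq T) : head x0 (rev s) = last x0 s.
Proof. by rewrite -last_rev revK. Qed.

Lemma mem_split_pred x0 (s : seq T) w : w \in s -> w != head x0 s ->
  exists s1 y s2, s = rcons s1 y ++ w :: s2.
Proof.
move=> /splitPr [s1 s2]; case/lastP: s1 => [|s1 y]; first by rewrite eqxx.
by exists s1, y, s2.
Qed.

End Splitting.

(** * Ore's rotation argument and saturation *)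

Section Ore.
Variables (V : finType) (e : rel V).
Hypothesis e_simple : simple_graph e.

Definition add_edge (u v : V) : rel V :=
  fun x y => [|| e x y, (x == u) && (y == v) | (x == v) && (y == u)].

Lemma add_edge_simple u v : u != v -> simple_graph (add_edge u v).
Proof.
case: e_simple => esym eirr uv; split=> [x y|x]; rewrite /add_edge.
  by rewrite esym ![(y == _) && _]andbC; congr (_ || _); rewrite orbC.
rewrite eirr /=; apply/negbTE/norP; split; apply/negP => /andP [/eqP ->].
  by apply/negP.
by rewrite eq_sym; apply/negP.
Qed.

Let e_sym : symmetric e. Proof. by case: e_simple. Qed.
Let e_irr : irreflexive e. Proof. by case: e_simple. Qed.

Let rev_sorted_e s : sorted e (rev s) = sorted e s.
Proof. by rewrite rev_sorted; apply: eq_sorted => x y; rewrite e_sym. Qed.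

(** * Rotations of a Hamiltonian path broken at the missing edge [u v] *)

Section Rotation.
Variables (u v : V) (A B : seq V).
Hypotheses (A_path : sorted e A) (B_path : sorted e B).
Hypotheses (A_last : last u A = u) (B_head : head v B = v).
Hypotheses (A0 : A != [::]) (B0 : B != [::]).
Hypotheses (s_uniq : uniq (A ++ B)) (s_all : forall w, w \in A ++ B).
Hypothesis not_trace : ~ traceable e.

Let uA : u \in A.
Proof. by case: A A0 A_last => //= a A' _ <-; rewrite mem_last. Qed.

Let last_A x : last x A = u. Proof. by case: A A0 A_last. Qed.
Let head_B x : head x B = v. Proof. by case: B B0 B_head. Qed.

Let no_reorder s : perm_eq s (A ++ B) -> ~ sorted e s.
Proof.
move=> sAB s_path; apply: not_trace; exists s; split=> // [|w].
  by rewrite (perm_uniq sAB).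
by rewrite (perm_mem sAB).
Qed.

Let pred w := nth u (A ++ B) (index w (A ++ B)).-1.

Let predE s1 y w s2 : A ++ B = rcons s1 y ++ w :: s2 -> pred w = y.
Proof.
move=> sE; have := s_uniq; rewrite /pred sE cat_uniq.
case/and3P => _ /norP [/= w1 _] _.
by rewrite index_cat (negbTE w1) /= eqxx addn0 nth_cat size_rcons /= ltnSn
  nth_rcons ltnn eqxx.
Qed.

Let head_notin : ~~ e v (head u A).
Proof.
apply/negP => vA; apply: (@no_reorder (rev A ++ B)).
  by rewrite perm_cat2r perm_rev.
by apply: (@sorted_cat_head _ _ u); rewrite ?rev_sorted_e // head_B last_rev e_sym.
Qed.

Let last_notin : ~~ e u (last v B).
Proof.
apply/negP => uB; apply: (@no_reorder (A ++ rev B)).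
  by rewrite perm_cat2l perm_rev.
by apply: (@sorted_cat_head _ _ v); rewrite ?rev_sorted_e // last_A head_rev.
Qed.

(* If [pred w] were adjacent to [u], then [A] and [B] could be reconnected
   through the edges from [v] to [w] and from [u] to [pred w]. *)
Let pred_notin w : e v w -> ~~ e u (pred w) /\ (pred w \notin [:: u; last v B]).
Proof.
have not_last t y r : A ++ B = rcons t y ++ w :: r -> y != last v B.
  move=> sE; have <- : last v (A ++ B) = last v B by rewrite last_cat; case: B B0.
  rewrite sE last_cat /=; have := s_uniq; rewrite sE cat_uniq => /and3P [_ yn _].
  apply: contraNneq yn => yl; apply/hasP; exists y; first by rewrite yl mem_last.
  by rewrite mem_rcons inE eqxx.
move=> vw; have := s_all w; rewrite mem_cat => /orP [wA|wB].
  have [|A1 [y [A2 AE]]] := @mem_split_pred _ u _ _ wA.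
    by apply: contraNneq head_notin => <-.
  have sE : A ++ B = rcons A1 y ++ w :: (A2 ++ B) by rewrite AE -catA.
  rewrite (predE sE) !inE negb_or (not_last _ _ _ sE) andbT.
  have uA2 : last w A2 = u by rewrite -(last_A u) AE last_cat.
  move: A_path; rewrite AE => /cat_sorted2 [A1_path wA2_path].
  split; last first.
    have := s_uniq; rewrite AE cat_uniq => /andP [].
    rewrite cat_uniq => /and3P [_ yn _] _; apply: contraNneq yn => yu.
    apply/hasP; exists y; first by rewrite yu -uA2 mem_last.
    by rewrite mem_rcons inE eqxx.
  (* The new order runs through [A1] to [y], jumps to [u], goes back to [w] and enters [B] at
     [v]. *)
  apply/negP => uy; apply: (@no_reorder ((rcons A1 y ++ rev (w :: A2)) ++ B)).
    by rewrite AE perm_cat2r perm_cat2l perm_rev.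
  apply: (@sorted_cat_head _ _ u) => //; last first.
    by rewrite last_cat last_rev head_B e_sym.
  apply: (@sorted_cat_head _ _ u); rewrite ?rev_sorted_e //.
  by rewrite last_rcons head_rev /= uA2 e_sym.
have [|B1 [y [B2 BE]]] := @mem_split_pred _ v _ _ wB.
  by rewrite head_B; apply: contraTneq vw => ->; rewrite e_irr.
have sE : A ++ B = rcons (A ++ B1) y ++ w :: B2 by rewrite BE rcons_cat catA.
rewrite (predE sE) !inE negb_or (not_last _ _ _ sE) andbT.
move: B_path; rewrite BE => /cat_sorted2 [B1_path wB2_path].
have yB : y \in B by rewrite BE mem_cat mem_rcons inE eqxx.
split; last first.
  have := s_uniq; rewrite cat_uniq => /and3P [_ yn _]; apply: contraNneq yn => yu.
  by apply/hasP; exists y; rewrite //= yu uA.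
(* The new order runs through [A] to [u], jumps to [y], goes back to [v] and continues from [w]. *)
apply/negP => uy; apply: (@no_reorder ((A ++ rev (rcons B1 y)) ++ w :: B2)).
  by rewrite BE -catA perm_cat2l perm_cat2r perm_rev.
apply: (@sorted_cat_head _ _ u) => //; last first.
  rewrite last_cat last_rev; have := head_B (last u A); rewrite BE.
  by case: (B1) => [|b B1'] /= ->.
apply: (@sorted_cat_head _ _ u); rewrite ?rev_sorted_e //.
by rewrite last_A head_rev last_rcons.
Qed.

(** The neighbours of [u] and the predecessors of the neighbours of [v] form disjoint sets, and both
    sets avoid the two vertices [u] and [last v B]. *)
Lemma split_deg_sum : deg e u + deg e v <= #|V| - 2.
Proof.
have pred_inj : {in [set w | e v w] &, injective pred}.
  (* At index [0] the truncated [pred] would collide with index [1]; [head_notin] excludes that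
     index. *)
  have idx_gt0 w : e v w -> 0 < index w (A ++ B).
    move=> vw; rewrite lt0n; apply: contraNneq head_notin => w0.
    have <- : w = head u A; last by [].
    have := nth_index u (s_all w); rewrite w0.
    by case: A A0 => //= ? ? _ <-.
  move=> w w'; rewrite !inE => /idx_gt0 w0 /idx_gt0 w0'.
  have lt z : index z (A ++ B) < size (A ++ B) by rewrite index_mem.
  move/eqP; rewrite nth_uniq //; try exact: leq_ltn_trans (leq_pred _) (lt _).
  move/eqP => ww'; have ww : index w (A ++ B) = index w' (A ++ B).
    by clear -w0 w0' ww'; lia.
  by rewrite -(nth_index u (s_all w)) ww nth_index.
have ul : u != last v B.
  have lB : last v B \in B by case: B B0 => //= b B' _; apply: mem_last.
  have := s_uniq; rewrite cat_uniq => /and3P [_ un _]; apply: contraNneq un => uE.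
  by apply/hasP; exists u; rewrite // uE.
rewrite /deg -(card_in_imset pred_inj).
have dis : [set w | e u w] :&: pred @: [set w | e v w] = finset.set0.
  apply/setP => z; rewrite !inE; apply/negbTE/negP => /andP [uz].
  by case/imsetP => w; rewrite inE => /pred_notin [+ _] zE; rewrite -zE uz.
rewrite -cardsUI dis cards0 addn0 -(cardsC [set u; last v B]) cards2 ul addKn.
apply/subset_leq_card/fintype.subsetP => z; rewrite !inE => /orP [uz|].
  rewrite negb_or; apply/andP; split.
    by apply: contraTneq uz => ->; rewrite e_irr.
  by apply: contraTneq uz => ->.
by case/imsetP => w; rewrite inE => /pred_notin [_ +] ->; rewrite !inE.
Qed.

End Rotation.

(** One step of the Bondy-Chvatal closure: a Hamiltonian path that is not one of [e] must use the
    new edge, and cutting it there gives the two pieces for [split_deg_sum]. *)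
Lemma traceable_add_edge (u v : V) : u != v -> ~~ e u v ->
  #|V|.-1 <= deg e u + deg e v -> traceable (add_edge u v) -> traceable e.
Proof.
move=> uv nuv duv [s [s_path s_uniq s_all]]; apply: contrapT => not_trace.
have s_nsorted : ~~ sorted e s by apply/negP => es; apply: not_trace; exists s.
have [A [x [y [B [sE nxy]]]]] := not_sorted_split s_nsorted.
move: s_path; rewrite sE cat_rcons => s_path.
have xy : (x == u) && (y == v) || (x == v) && (y == u).
  have [_] := cat_sorted2 s_path; rewrite /= => /andP [+ _].
  by rewrite /add_edge (negbTE nxy).
have y_nA : y \notin rcons A x.
  have := s_uniq; rewrite sE cat_uniq => /and3P [_ /hasPn + _].
  by apply; rewrite inE eqxx.
have x_nB : x \notin y :: B.
  have := s_uniq; rewrite sE cat_uniq => /and3P [_ /hasPn xn _].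
  by apply/negP => /xn; rewrite mem_rcons inE eqxx.
(* A piece that avoids an endpoint of the new edge has all its edges in [e]. *)
have sub z : (z == x) || (z == y) -> {in predC1 z &, subrel (add_edge u v) e}.
  move=> zE a b; rewrite !inE => az bz /or3P [] // /andP [/eqP aE /eqP bE];
  move: az bz zE; rewrite aE bE;
  by case/orP: xy => /andP [/eqP -> /eqP ->];
    rewrite 2![z == _]eq_sym => /negbTE-> /negbTE->.
have A_path : sorted e (rcons A x).
  apply: (sub_in_sorted (sub y _)); rewrite ?eqxx ?orbT //.
    by apply/allP => z zA /=; apply: contraNneq y_nA => <-.
  by move: s_path; rewrite -cat_rcons => /cat_sorted2 [].
have B_path : sorted e (y :: B).
  apply: (sub_in_sorted (sub x _)); rewrite ?eqxx //.
    by apply/allP => z zB /=; apply: contraNneq x_nB => <-.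
  by move: s_path; rewrite -cat_rcons => /cat_sorted2 [].
have s_uniq' : uniq (rcons A x ++ y :: B) by rewrite -sE.
have s_all' w : w \in rcons A x ++ y :: B by rewrite -sE.
have A0 : rcons A x != [::] by case: (A).
have V2 : 1 < #|V| by rewrite (cardD1 u) (cardD1 v) !inE eq_sym uv.
have {x y xy nxy sub y_nA x_nB sE s_path A_path B_path s_uniq' s_all' A0 A B}
    : deg e u + deg e v <= #|V| - 2.
  have := split_deg_sum A_path B_path (last_rcons _ _ _) (erefl _) A0 isT
    s_uniq' s_all' not_trace.
  by case/orP: xy => /andP [/eqP -> /eqP ->] //; rewrite addnC.
by clear -V2 duv; lia.
Qed.

End Ore.

(** Induction on the number of nonadjacent ordered pairs, which every added edge lowers. *)
Lemma saturate (V : finType) (e : rel V) : simple_graph e -> ~ traceable e ->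
  exists h : rel V, [/\ simple_graph h, subrel e h, ~ traceable h
    & forall u v, u != v -> ~~ h u v -> deg h u + deg h v < #|V|.-1].
Proof.
pose missing (h : rel V) := #|[pred p : V * V | ~~ h p.1 p.2]|.
have [k] := ubnP (missing e); elim: k e => // k IHk e ek e_simple nt.
have [/existsP [[u v] /and3P [/= uv nuv duv]]|sat] := boolP
    [exists p : V * V, [&& p.1 != p.2, ~~ e p.1 p.2
      & #|V|.-1 <= deg e p.1 + deg e p.2]]; last first.
  exists e; split=> // u v uv nuv; move: sat; rewrite negb_exists.
  by move=> /forallP /(_ (u, v)); rewrite /= uv nuv /= -ltnNge.
have [|||h [h_simple eh nth hsat]] := IHk (add_edge e u v).
- rewrite -ltnS; apply: leq_trans ek; rewrite ltnS; apply: proper_card.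
  apply/properP; split.
    apply/fintype.subsetP => p; rewrite !inE /add_edge negb_or.
    by case/andP.
  by exists (u, v); rewrite !inE //= /add_edge !eqxx orbT.
- exact: add_edge_simple.
- by move=> /(traceable_add_edge e_simple uv nuv duv).
exists h; split=> // x y xy; apply: eh.
by rewrite /add_edge xy.
Qed.

Lemma sorted_uniq_complete (T : eqType) (r : rel T) (s : seq T) :
  uniq s -> (forall x y, x != y -> r x y) -> sorted r s.
Proof.
move=> + r_all; case: s => // x s; elim: s x => // y s IHs x.
move=> /andP [xys ys]; apply/andP; split; last exact: IHs.
by apply: r_all; apply: contraNneq xys => ->; rewrite inE eqxx.
Qed.

(** * Degree structure of a saturated graph *)

Section Saturated.
Variables (V : finType) (h : rel V) (t : nat).
Hypotheses (h_simple : simple_graph h) (h_nt : ~ traceable h).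
Hypothesis h_sat :
  forall u v, u != v -> ~~ h u v -> deg h u + deg h v < #|V|.-1.
Hypothesis h_deg : forall v, t <= deg h v.

Let h_sym : symmetric h. Proof. by case: h_simple. Qed.
Let h_irr : irreflexive h. Proof. by case: h_simple. Qed.

Definition clique (C : {set V}) : bool :=
  [forall u in C, forall v in C, (u != v) ==> h u v].

Lemma cliqueP (C : {set V}) : reflect {in C &, forall u v, u != v -> h u v} (clique C).
Proof.
apply: (iffP forall_inP) => [cl u v uC vC uv|cl u uC].
  by have /forall_inP/(_ v vC)/implyP := cl u uC; apply.
by apply/forall_inP => v vC; apply/implyP; apply: cl.
Qed.

Definition deg_in (C : {set V}) (v : V) : nat := #|[set w in C | h v w]|.

Lemma deg_split C v : deg h v = deg_in C v + deg_in (~: C) v.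
Proof.
rewrite /deg /deg_in  -(cardsID C); congr (_ + _).
  by apply: eq_card => w; rewrite !inE andbC.
by apply: eq_card => w; rewrite !inE.
Qed.

Lemma clique_deg_in C v : clique C -> v \in C -> deg_in C v = #|C|.-1.
Proof.
move=> /cliqueP cl vC; rewrite (cardsD1 v C) vC /=; apply: eq_card => w.
rewrite !inE andbC; have [->|wv] := eqVneq w v; first by rewrite h_irr.
by case wC: (w \in C); rewrite ?andbF // cl // eq_sym.
Qed.

(* [C] is a maximal clique containing every vertex of degree at least
   [(#|V| - 1) / 2]. *)
Lemma saturated_structure : exists C : {set V},
  [/\ clique C,
      forall w, w \notin C -> deg h w <= #|~: C|.-1,
      forall w, w \notin C -> (deg h w).*2 <= #|V| - 2,
      t < #|~: C|
    & forall v, v \in C ->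
        (forall w, w \notin C -> h v w) \/ deg_in (~: C) v + t < #|~: C|].
Proof.
pose C0 := [set v | #|V|.-1 <= (deg h v).*2].
have C0_cl : clique C0.
  apply/cliqueP => u v; rewrite !inE => du dv uv.
  by apply/negPn/negP => /(h_sat uv); lia.
have [C /maxsetP [C_cl C_max] C0C] := maxset_exists C0_cl.
have C_nadj w : w \notin C -> exists2 v, v \in C & ~~ h v w.
  move=> wC; apply/exists_inP; apply: contraNT wC => nadj.
  have adj v : v \in C -> h v w.
    by move=> vC; apply: contraNT nadj => nvw; apply/exists_inP; exists v.
  rewrite -(C_max (w |: C)) ?setU11 //; last exact: finset.subsetUr.
  apply/cliqueP => u v; rewrite !inE => /orP [/eqP->|uC] /orP [/eqP->|vC] uv.
  - by rewrite eqxx in uv.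
  - by rewrite h_sym adj.
  - exact: adj.
  - by move/cliqueP: C_cl; apply.
have C_deg v : v \in C -> deg h v = #|C|.-1 + deg_in (~: C) v.
  by move=> vC; rewrite (deg_split C) clique_deg_in.
have C_card : #|C| + #|~: C| = #|V| by rewrite cardsC.
(* By maximality some [v] in [C] is not adjacent to [w]. Its degree is at least [#|C| - 1], so
   saturation leaves less than [#|~: C|] for [w]. *)
have low : forall w, w \notin C -> deg h w <= #|~: C|.-1.
  move=> w wC; have [v vC nvw] := C_nadj w wC.
  have vw : v != w by apply: contraNneq wC => <-.
  have C0' : 0 < #|C| by apply/card_gt0P; exists v.
  have W0 : 0 < #|~: C| by apply/card_gt0P; exists w; rewrite inE.
  have := h_sat vw nvw; rewrite (C_deg v vC); lia.
(* If [C] contained every vertex, [h] would be complete and any enumeration a Hamiltonian path. *)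
have [w wC] : exists w, w \notin C.
  apply/existsP; rewrite -negb_forall; apply/negP => /forallP C_all.
  apply: h_nt; exists (enum V); split; rewrite ?enum_uniq //.
    2: by move=> v; rewrite mem_enum.
  apply: sorted_uniq_complete => [|u v uv]; first exact: enum_uniq.
  by move/cliqueP: C_cl; apply.
have W0 : 0 < #|~: C| by apply/card_gt0P; exists w; rewrite inE.
exists C; split=> [//|//|u uC||v vC].
- have : u \notin C0 by apply: contra uC; apply: (fintype.subsetP C0C).
  by rewrite inE; lia.
- by have := low w wC; have := h_deg w; lia.
have [all_adj|] := boolP [forall w in ~: C, h v w].
  by left=> u uC; apply: (forall_inP all_adj); rewrite inE.
rewrite negb_forall_in => /exists_inP [u]; rewrite inE => uC nvu; right.
have vu : v != u by apply: contraNneq uC => <-.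
have C0' : 0 < #|C| by apply/card_gt0P; exists v.
have := h_sat vu nvu; rewrite (C_deg v vC); have := h_deg u; lia.
Qed.

End Saturated.

(** * Numerical estimates *)

Section RayleighEstimates.
Local Open Scope ring_scope.
Variable R : realFieldType.

(** What [rayleigh_excess] leaves beyond the multiple of [delta]. There [m = k - t] and [r = t - s]
    measure the deviation from the extremal graph, for which [m], [r], [i], [e] and the excess
    vanish. *)
Definition excess (t m r i e u c d : R) : R :=
  m * (u * (c ^+ 2 - 1) + 2 * (t * c) + (m + 1) * c ^+ 2)
  + 2 * c * (t + m) * (r - m) - c ^+ 2 * i - 2 * c * e - r * (u * d ^+ 2)
  + (m * (c - 1) + r * d) ^+ 2.

(* [k], [s] and [n - k - s] are the numbers of vertices of weight [c], [1 - d]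
   and [1]; [i] counts the adjacent ordered pairs inside the first class and [e]
   the edges from it to the third; all pairs not inside the first class or
   between it and the third are adjacent. *)
Lemma rayleigh_excess (n t k s i e u c d : R) :
    u * d = t * c -> (u + 1) * c = u + n - 2 * t -> c != 0 ->
  let r := t - s in let m := k - t in let N := n - 2 * t in
  let delta := t * (1 - d) + N + 2 * (t * c) - u in
  (s * (1 - d) + (n - k - s) + k * c) ^+ 2
    + (c ^+ 2 * (k * (k - 1) - i) + 2 * c * (k * (n - k - s) - e))
    - u * (s * (1 - d) ^+ 2 + (n - k - s) + k * c ^+ 2)
  = delta * (t * (1 - d) + N + t * c + 2 * m * (c - 1) + 2 * r * d)
    + excess t m r i e u c d.
Proof.
move=> ud uc c0 r m N delta; rewrite /excess /delta /N /r /m.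
(* Solving the two relations for [n] and [t] turns the claim into an identity of rational
   functions. *)
have -> : n = (u + 1) * c - u + 2 * t by rewrite uc; ring.
have -> : t = u * d / c by rewrite ud mulfK.
by field.
Qed.

(** Bounding [i] through [i + e], then [e], and the square by its value at [r = 0] leaves an
    expression linear in [r]. Its part with [r] is [r_term]; the rest is [m] times [bracket] plus
    [drop]. *)
Lemma excess_gt0_pos (t m r i e u c d N : R) :
    1 <= t -> 5 * t + 2 <= N -> N + 2 * t <= u -> 1 <= c <= 2 -> 0 <= d ->
    u * d = t * c -> u * (c - 1) = N - c -> 1 <= m -> 2 * m <= N - 1 ->
    0 <= i -> 0 <= e -> e <= (m - 1) * (N - m + r) ->
    i + e <= (t + m) * (m - 1 + r) ->
    0 <= r ->
  0 < excess t m r i e u c d.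
Proof.
move=> t_ge1 N_ge u_ge /andP [c_ge1 c_le2] d_ge0 ud uc m_ge1 m_le i_ge0 e_ge0
  e_le ie_le r_sgn.
have c_diff : 0 <= 2 * c - c ^+ 2.
  by have -> : 2 * c - c ^+ 2 = c * (2 - c) by [ring]; apply: mulr_ge0; lra.
have uc2 : u * (c ^+ 2 - 1) = (N - c) * (c + 1) by rewrite -uc; ring.
have u_gt0 : 0 < u by lra.
have slope : t * d <= (2 - c) * (t + 1).
  rewrite -(ler_pM2l u_gt0) mulrCA ud.
  have u2c : 2 * t + 1 <= u * (2 - c).
    have -> : u * (2 - c) = u - u * (c - 1) by ring.
    by rewrite uc; lra.
  have lower : (2 * t + 1) * (t + 1) <= u * (2 - c) * (t + 1).
    by apply: ler_wpM2r => //; lra.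
  have upper : t * (t * c) <= t * (t * 2) by do 2!(apply: ler_wpM2l; first lra).
  by rewrite mulrA; lra.
have r_term : 0 <= r * ((2 * c - c ^+ 2) * (t + 1) - u * d ^+ 2).
  have -> : u * d ^+ 2 = t * c * d by rewrite -ud; ring.
  have -> : (2 * c - c ^+ 2) * (t + 1) - t * c * d
    = c * ((2 - c) * (t + 1) - t * d) by ring.
  by apply: mulr_ge0 => //; apply: mulr_ge0; lra.
have i_term : c ^+ 2 * i <= c ^+ 2 * ((t + m) * (m - 1 + r) - e).
  by apply: ler_wpM2l; [apply: sqr_ge0 | lra].
have e_term := ler_wpM2l c_diff e_le.
have sq_term : (m * (c - 1)) ^+ 2 <= (m * (c - 1) + r * d) ^+ 2.
  have : 0 <= m * (c - 1) by apply: mulr_ge0; lra.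
  have : 0 <= r * d by apply: mulr_ge0.
  by move=> ? ?; rewrite ler_pXn2r // ?nnegrE; lra.
(* The largest [m] and then the smallest [N] leave, up to positive terms, [t] times a quadratic in
   [c], completed to a square in [tb]. *)
have bracket : 0 < N * (c ^+ 2 - c + 1) - c ^+ 2 * t - m * (2 * c - 1) + c ^+ 2 - c.
  have mb : m * (2 * c - 1) <= (N - 1) / 2 * (2 * c - 1) by apply: ler_wpM2r; lra.
  have Nb : (5 * t + 2) * ((c - 1) ^+ 2 + 2^-1) <= N * ((c - 1) ^+ 2 + 2^-1).
    apply: ler_wpM2r => //; have := sqr_ge0 (c - 1); have := sqr_ge0 c; lra.
  have tb : 0 < t * (4 * (c - 5 / 4) ^+ 2 + 5 / 4).
    apply: mulr_gt0; first lra; have := sqr_ge0 (c - 5 / 4); lra.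
  have := sqr_ge0 (c - 1); have := sqr_ge0 c; lra.
have drop : 0 <= c ^+ 2 * t + (2 * c - c ^+ 2) * (N - m).
  by apply: addr_ge0; apply: mulr_ge0 => //; [apply: sqr_ge0 | lra | lra].
have := mulr_gt0 (lt_le_trans ltr01 m_ge1) bracket.
rewrite /excess uc2; lra.
Qed.

(** Since [c ^+ 2 <= 2 * c], the bound on [i + e] applies as a whole. Outside the final square, the
    only term with [r] that survives is [- r * (u * d ^+ 2)], which is nonnegative, next to [m]
    times [bracket] plus [2 * (t * c)]. *)
Lemma excess_gt0_neg (t m r i e u c d N : R) :
    1 <= t -> 5 * t + 2 <= N -> N + 2 * t <= u -> 1 <= c <= 2 -> 0 <= d ->
    u * d = t * c -> u * (c - 1) = N - c -> 1 <= m -> 2 * m <= N - 1 ->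
    0 <= i -> 0 <= e -> e <= (m - 1) * (N - m + r) ->
    i + e <= (t + m) * (m - 1 + r) ->
    r <= 0 ->
  0 < excess t m r i e u c d.
Proof.
move=> t_ge1 N_ge u_ge /andP [c_ge1 c_le2] d_ge0 ud uc m_ge1 m_le i_ge0 e_ge0
  e_le ie_le r_sgn.
have c_diff : 0 <= 2 * c - c ^+ 2.
  by have -> : 2 * c - c ^+ 2 = c * (2 - c) by [ring]; apply: mulr_ge0; lra.
have uc2 : u * (c ^+ 2 - 1) = (N - c) * (c + 1) by rewrite -uc; ring.
have i_term : c ^+ 2 * i + 2 * c * e <= 2 * c * ((t + m) * (m - 1 + r)).
  have := mulr_ge0 c_diff i_ge0; have : 0 <= 2 * c by lra.
  move=> /ler_wpM2l /(_ _ _ ie_le); lra.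
have r_term : 0 <= - r * (u * d ^+ 2).
  by apply: mulr_ge0; [lra | apply: mulr_ge0; [lra | apply: sqr_ge0]].
have bracket : 0 < N * (c + 1) - 2 * (t * c) - m * (4 * c - c ^+ 2) + c.
  have mb : m * (4 * c - c ^+ 2) <= (N - 1) / 2 * (4 * c - c ^+ 2).
    by apply: ler_wpM2r; lra.
  have Nb : (5 * t + 2) * ((c - 1) ^+ 2 / 2 + 2^-1) <= N * ((c - 1) ^+ 2 / 2 + 2^-1).
    by apply: ler_wpM2r => //; have := sqr_ge0 (c - 1); have := sqr_ge0 c; lra.
  (* Only [1/10] is left at [c = 7/5], so the constant [5] in [5 * t + 2 <= N] is almost used up. *)
  have tb : 0 < t * (5 / 2 * (c - 7 / 5) ^+ 2 + 10^-1).
    by apply: mulr_gt0; [lra | have := sqr_ge0 (c - 7 / 5); lra].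
  have := sqr_ge0 (c - 1); have := sqr_ge0 c; lra.
have := mulr_gt0 (lt_le_trans ltr01 m_ge1) bracket.
have tc : 0 < t * c by apply: mulr_gt0; lra.
have := sqr_ge0 (m * (c - 1) + r * d).
rewrite /excess uc2; lra.
Qed.

End RayleighEstimates.

Section RayleighQuotient.
Local Open Scope ring_scope.
Variable R : realFieldType.

(** For the values [1 - d], [1], [c] on the parts of the extremal graph, the two equations are
    differences of rows of the eigenvector equation. The one remaining row would say [delta = 0]. *)
Lemma test_weights (n t u : R) : 1 <= t -> 7 * t + 2 <= n -> n <= u ->
  exists c d, [/\ 1 <= c <= 2, 0 <= d <= 1, u * d = t * c
    & (u + 1) * c = u + n - 2 * t].
Proof.
move=> t1 n_ge u_ge; pose c := (u + n - 2 * t) / (u + 1).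
have c1 : 1 <= c by rewrite ler_pdivlMr; lra.
have c2 : c <= 2 by rewrite ler_pdivrMr; lra.
have tc0 : 0 <= t * c by apply: mulr_ge0; lra.
have tc2 : t * c <= t * 2 by apply: ler_wpM2l; lra.
exists c, (t * c / u); split.
- by rewrite c1 c2.
- by rewrite divr_ge0 ?ler_pdivrMr ?mul1r //; lra.
- by rewrite mulrC divfK //; apply: lt0r_neq0; lra.
by rewrite mulrC divfK //; apply: lt0r_neq0; lra.
Qed.

Lemma rayleigh_few (n t k s i e u c d : R) :
    1 <= t -> 7 * t + 2 <= n -> n <= u -> 1 <= c <= 2 -> 0 <= d <= 1 ->
    u * d = t * c -> (u + 1) * c = u + n - 2 * t ->
    0 <= t * (1 - d) + (n - 2 * t) + 2 * (t * c) - u ->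
    t + 1 <= k -> 2 * k <= n - 1 -> 0 <= i -> 0 <= e ->
    e <= (k - t - 1) * (n - k - s) -> i + s * k + e <= k * (k - 1) ->
  u * (s * (1 - d) ^+ 2 + (n - k - s) + k * c ^+ 2)
  < (s * (1 - d) + (n - k - s) + k * c) ^+ 2
    + (c ^+ 2 * (k * (k - 1) - i) + 2 * c * (k * (n - k - s) - e)).
Proof.
move=> t1 n_ge u_ge c12 /andP [d0 d1] ud uc delta0 k_ge k_le i0 e0 e_le ie_le.
have /andP [c1 c2] := c12; have c_neq0 : c != 0 by apply: lt0r_neq0; lra.
rewrite -subr_gt0 (rayleigh_excess k s i e ud uc c_neq0) /=.
set m := k - t; set r := t - s; set N := n - 2 * t in delta0 *.
have kE : k = t + m by rewrite /m; ring.
have e_le' : e <= (m - 1) * (N - m + r).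
  by have <- : n - k - s = N - m + r by [rewrite /N /m /r; ring].
have ie_le' : i + e <= (t + m) * (m - 1 + r).
  have -> : (t + m) * (m - 1 + r) = k * (k - 1) - s * k by rewrite /m /r; ring.
  by lra.
have r_ge : 0 <= m - 1 + r.
  have k0 : 0 < t + m by rewrite -kE; lra.
  by rewrite -(pmulr_rge0 _ k0); apply: le_trans ie_le'; lra.
have excess0 : 0 < excess t m r i e u c d.
  case/orP: (le_total 0 r) => r0; [apply: (@excess_gt0_pos _ _ _ _ _ _ _ _ _ N)
    | apply: (@excess_gt0_neg _ _ _ _ _ _ _ _ _ N)] => //;
  by rewrite /N /m; lra.
(* Together with [2 * m <= N - 1] this keeps the factor of [delta] nonnegative in spite of its term
   [2 * r * d]. *)
have rd : - m <= r * d.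
  have : - (m - 1) * d <= r * d by apply: ler_wpM2r; lra.
  have : (m - 1) * d <= (m - 1) * 1 by apply: ler_wpM2l; rewrite /m; lra.
  by rewrite mulNr; lra.
apply: ltr_wpDl => //; apply: mulr_ge0 => //.
have : 0 <= t * (1 - d) by apply: mulr_ge0; lra.
have : 0 <= t * c by apply: mulr_ge0; lra.
have : 0 <= m * (c - 1) by rewrite /m; apply: mulr_ge0; lra.
by rewrite /N /m in rd *; lra.
Qed.

(** Multiplied by [u + 1], the last hypothesis becomes quadratic in [u]. For [n = 7 t] its leading
    terms bound [u / n] by [(8 + sqrt 104) / 14], just below [13 / 10]. *)
Lemma radius_le (n t u c d : R) :
    1 <= t -> 7 * t + 2 <= n -> n <= u -> 0 <= d ->
    (u + 1) * c = u + n - 2 * t ->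
    0 <= t * (1 - d) + (n - 2 * t) + 2 * (t * c) - u ->
  10 * u <= 13 * n.
Proof.
move=> t1 n_ge u_ge d0 uc delta0; rewrite leNgt; apply/negP => u_gt.
have td : 0 <= t * d by apply: mulr_ge0; lra.
have quad : u * (u + 1) <= (n - t) * (u + 1) + 2 * t * (u + n - 2 * t).
  rewrite -uc.
  have -> : 2 * t * ((u + 1) * c) = 2 * (t * c) * (u + 1) by ring.
  by rewrite -mulrDl; apply: ler_wpM2r; lra.
pose w := n - 7 * t; pose x := 10 * u - 13 * n.
have w2 : 0 <= t * (w - 2) by apply: mulr_ge0; rewrite /w; lra.
have ww : 0 <= w ^+ 2 by apply: sqr_ge0.
have x0 : 0 <= x ^+ 2 by apply: sqr_ge0.
have xn : 0 <= x * (n - t) by apply: mulr_ge0; rewrite /x; lra.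
have tt : 0 <= t ^+ 2 by apply: sqr_ge0.
have xx : 0 <= x * t by apply: mulr_ge0; rewrite /x; lra.
rewrite /w /x in w2 ww x0 xn xx; lra.
Qed.

(** As [9/4 i + 3 e = 9/4 (i + e) + 3/4 e], the bounds reduce the claim to
    [3/10 n^2 < n k / 2 + k^2 / 4], which [n <= 2 k] gives with [n^2 / 80] to spare. *)
Lemma rayleigh_many (n k i e u : R) :
    0 < n -> 10 * u <= 13 * n -> n <= 2 * k -> e <= k * (n - k) ->
    i + e <= k * ((n - 2) / 2) ->
  u * ((n - k) + k * (3 / 2) ^+ 2)
  < ((n - k) + k * (3 / 2)) ^+ 2
    + ((3 / 2) ^+ 2 * (k * (k - 1) - i) + 2 * (3 / 2) * (k * (n - k) - e)).
Proof.
move=> n0 u_le k_ge e_le ie_le.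
have uk : 10 * u * (n + 5 / 4 * k) <= 13 * n * (n + 5 / 4 * k).
  by apply: ler_wpM2r; lra.
have kk : 0 <= (2 * k - n) * k by apply: mulr_ge0; lra.
have kn : 0 <= (2 * k - n) * n by apply: mulr_ge0; lra.
have nn : 0 < n * n by apply: mulr_gt0.
lra.
Qed.

End RayleighQuotient.

(** * Rayleigh quotients of distance matrices *)

Section DegreeSums.
Variables (V : finType) (h : rel V).

Lemma deg_inE (A : {set V}) v : deg_in h A v = \sum_(w in A) h v w.
Proof.
rewrite /deg_in -sum1dep_card big_mkcondr; apply: eq_bigr => w _.
by case: (h v w).
Qed.

Lemma sum_deg_in (A B : {set V}) : symmetric h ->
  \sum_(v in A) deg_in h B v = \sum_(v in B) deg_in h A v.
Proof.
move=> h_sym; under eq_bigr do rewrite deg_inE.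
rewrite exchange_big; apply: eq_bigr => v _; rewrite deg_inE.
by apply: eq_bigr => w _; rewrite h_sym.
Qed.

Definition codeg_in (A : {set V}) v : nat :=
  \sum_(w in A) ((v != w) && ~~ h v w).

Lemma codeg_in_notin (A : {set V}) v : v \notin A ->
  codeg_in A v + deg_in h A v = #|A|.
Proof.
move=> vA; rewrite deg_inE -big_split -sum1_card; apply: eq_bigr => w wA.
have -> : v != w by apply: contraNneq vA => ->.
by case: (h v w).
Qed.

Lemma codeg_in_in (A : {set V}) v : irreflexive h -> v \in A ->
  codeg_in A v + deg_in h A v = #|A|.-1.
Proof.
move=> h_irr vA; rewrite deg_inE -big_split (bigD1 v) //= eqxx h_irr add0n.
rewrite (cardD1 v) vA /= -sum1_card; apply: eq_big => [w|w /andP [wA wv]].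
  by rewrite !inE andbC.
by rewrite eq_sym wv; case: (h v w).
Qed.

End DegreeSums.

(** * Lower bounds for [mu] from nonadjacent pairs *)

Section DistanceQuotient.
Local Open Scope ring_scope.
Variables (R : realType) (V : finType) (e h : rel V).
Hypotheses (e_sym : symmetric e) (h_simple : simple_graph h).
Hypothesis eh : subrel e h.

(** Distinct vertices have distance at least one, and at least two if nonadjacent in [h], since they
    are then nonadjacent in [e]. The diagonal of the squared sum accounts for the [+ 1]. *)
Lemma distance_form_ge (f : V -> R) : (forall x, 0 <= f x) ->
  (\sum_x f x) ^+ 2
    + \sum_x \sum_z f x * f z * ((x != z) && ~~ h x z)%:R
  <= (mu R e + 1) * \sum_x f x ^+ 2.
Proof.
move=> f_ge0; rewrite mulrDl mul1r -lerBlDr.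
apply: le_trans (distance_form_le f e_sym).
rewrite expr2 mulr_suml addrAC -sumrB -big_split; apply: ler_sum => x _ /=.
have -> : f x * (\sum_z f z) - f x ^+ 2 = f x * \sum_(z | z != x) f z.
  by rewrite [in LHS](bigD1 x) //=; ring.
rewrite mulr_sumr.
rewrite [X in _ + X](bigD1 x) //=.
rewrite [X in _ <= X](bigD1 x) //= eqxx gdist_refl /= !mulr0 !add0r.
rewrite -big_split; apply: ler_sum => z zx /=.
rewrite -{1}[f x * f z]mulr1 -mulrDr; apply: ler_wpM2l.
  exact: mulr_ge0.
rewrite eq_sym in zx; rewrite zx /=; case hxz: (h x z) => /=.
  by rewrite addr0 ler1n gdist_gt0.
by rewrite -[1 + 1]/(2%:R) ler_nat gdist_gt1 //; apply: contraFN hxz; apply: eh.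
Qed.

(** Only the nonadjacent pairs inside [W] and between [W] and [K] are kept; the latter occur in both
    orders. *)
Lemma nonadjacent_weight_ge (f : V -> R) (W K : {set V}) (c : R) :
    (forall x, 0 <= f x) -> 0 <= c -> [disjoint W & K] ->
    {in W, forall x, f x = c} -> {in K, forall x, f x = 1} ->
  c ^+ 2 * (#|W|%:R * (#|W|%:R - 1) - (\sum_(w in W) deg_in h W w)%:R)
    + 2 * c * (#|W|%:R * #|K|%:R - (\sum_(w in W) deg_in h K w)%:R)
  <= \sum_x \sum_z f x * f z * ((x != z) && ~~ h x z)%:R.
Proof.
case: h_simple => h_sym h_irr f_ge0 c_ge0 WK fW fK.
pose B x z : R := ((x != z) && ~~ h x z)%:R.
have B_sym x z : B x z = B z x by rewrite /B eq_sym h_sym.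
have W_gt0 w : w \in W -> (0 < #|W|)%N by move=> wW; apply/card_gt0P; exists w.
have sum_codeg (A : {set V}) x : \sum_(z in A) B x z = (codeg_in h A x)%:R.
  by rewrite natr_sum.
have WW : \sum_(x in W) \sum_(z in W) B x z
    = #|W|%:R * (#|W|%:R - 1) - (\sum_(w in W) deg_in h W w)%:R.
  rewrite natr_sum mulr_natl -sumr_const -sumrB; apply: eq_bigr => x xW.
  rewrite sum_codeg -(natrB _ (W_gt0 x xW)) subn1 -(codeg_in_in h_irr xW).
  by rewrite natrD addrK.
have WK0 : \sum_(x in W) \sum_(z in K) B x z
    = #|W|%:R * #|K|%:R - (\sum_(w in W) deg_in h K w)%:R.
  rewrite natr_sum mulr_natl -sumr_const -sumrB; apply: eq_bigr => x xW.
  rewrite sum_codeg -(codeg_in_notin h (A := K) (v := x)) ?natrD ?addrK //.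
  by rewrite (disjointFr WK).
rewrite -WW -WK0.
have -> : c ^+ 2 * (\sum_(x in W) \sum_(z in W) B x z)
    + 2 * c * (\sum_(x in W) \sum_(z in K) B x z)
  = \sum_x \sum_z (c ^+ 2 * ((x \in W) && (z \in W))%:R
      + c * ((x \in W) && (z \in K))%:R + c * ((x \in K) && (z \in W))%:R) * B x z.
  have part (X Z : {set V}) (b : R) :
      \sum_x \sum_z b * ((x \in X) && (z \in Z))%:R * B x z
      = b * \sum_(x in X) \sum_(z in Z) B x z.
    rewrite mulr_sumr [RHS]big_mkcond; apply: eq_bigr => x _.
    rewrite mulr_sumr; case: (x \in X); last first.
      by rewrite big1 // => z _; rewrite mulr0 mul0r.
    rewrite [RHS]big_mkcond; apply: eq_bigr => z _.
    by case: (z \in Z); rewrite ?mulr1 // mulr0 mul0r.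
  under [RHS]eq_bigr do under eq_bigr do rewrite !mulrDl.
  under [RHS]eq_bigr do rewrite !big_split /=.
  rewrite !big_split /= !part.
  have -> : \sum_(x in K) \sum_(z in W) B x z = \sum_(x in W) \sum_(z in K) B x z.
    rewrite exchange_big; apply: eq_bigr => x _; apply: eq_bigr => z _; exact: B_sym.
  by ring.
apply: ler_sum => x _; apply: ler_sum => z _; apply: ler_wpM2r => //.
have dis y : y \in W -> y \in K = false by apply: disjointFr.
have ffxz : 0 <= f x * f z by apply: mulr_ge0.
case xW: (x \in W); case zW: (z \in W);
  rewrite ?(dis _ xW) ?(dis _ zW) /= ?mulr1 ?mulr0 ?addr0 ?add0r //.
- by rewrite !fW.
- case zK: (z \in K); rewrite ?mulr1 ?mulr0 ?addr0 //.
  by rewrite fW // fK // mulr1.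
- case xK: (x \in K); rewrite /= ?mulr1 ?mulr0 ?add0r //.
  by rewrite fK // fW // mul1r.
by rewrite andbF mulr0.
Qed.

End DistanceQuotient.

(** * The extremal graph *)

Section ExtremalGraph.
Local Open Scope ring_scope.
Variables (R : realType) (t q : nat).

Let G := graph_join (complete_graph t)
           (disjoint_union (complete_graph q) (edgeless_graph t)).

(** The nonadjacent pairs of distinct vertices, together with the diagonal of [t K_1]. Including
    that diagonal makes [far] constant on blocks, so that row sums become block sums. *)
Definition far (z x : 'I_t + ('I_q + 'I_t)) : bool :=
  match z, x with
  | inr (inr _), inr _ | inr _, inr (inr _) => true
  | _, _ => false
  end.

Lemma extremal_gdist_le z x : (1 < q)%N -> (0 < t)%N ->
  (gdist G z x <= (z != x) * (1 + far z x))%N.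
Proof.
move=> q1 t0; have [->|zx] := eqVneq z x; first by rewrite gdist_refl.
have V3 : (2 < #|{: 'I_t + ('I_q + 'I_t)}|)%N by rewrite !card_sum !card_ord; lia.
rewrite mul1n; case: (boolP (far z x)) => farzx.
  case: z x {zx} farzx => [i|[j|k]] [i'|[j'|k']] //= _;
    exact: (@gdist_common _ G _ _ (inl (Ordinal t0))).
apply: gdist_adj => //.
case: z x zx farzx => [i|[j|k]] [i'|[j'|k']] //= zx _;
  by rewrite /G /graph_join /disjoint_union /complete_graph;
     apply: contraNneq zx => ->.
Qed.

(** This sign and [n <= u] are all that the later estimates use about the extremal eigenvalue. *)
Lemma extremal_delta_ge0 (u c d : R) :
    u = mu R G + 1 -> (1 < q)%N -> (0 < t)%N -> 2 * t%:R < u -> 2 <= u ->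
    0 < c <= 2 -> u * d = t%:R * c -> (u + 1) * c = u + q%:R ->
  0 <= t%:R * (1 - d) + q%:R + 2 * (t%:R * c) - u.
Proof.
move=> uE q1 t0 ut u2 /andP [c0 c2] ud uc; rewrite leNgt; apply/negP.
set delta := _ - u => delta_lt0.
have tR : 0 < t%:R :> R by rewrite ltr0n.
have d0 : 0 <= d.
  have u0 : 0 < u by lra.
  by rewrite -(pmulr_rge0 _ u0) ud; apply: mulr_ge0; lra.
have d1 : d < 1.
  have u0 : 0 < u by lra.
  rewrite -(ltr_pM2l u0) ud mulr1.
  have : t%:R * c <= t%:R * 2 by apply: ler_wpM2l; lra.
  by lra.
(* [y] satisfies [D y = mu y + delta] entrywise, so a negative [delta] would
   allow [mu] to be lowered. *)
pose y (z : 'I_t + ('I_q + 'I_t)) : R :=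
  match z with inl _ => 1 - d | inr (inl _) => 1 | inr (inr _) => c end.
have y_gt0 z : 0 < y z by case: z => [i|[j|k]] /=; lra.
have y_le2 z : y z <= 2 by case: z => [i|[j|k]] /=; lra.
have sum_y (F : 'I_t + ('I_q + 'I_t) -> R) (b1 b2 b3 : R) :
    (forall i, F (inl i) = b1) -> (forall j, F (inr (inl j)) = b2) ->
    (forall k, F (inr (inr k)) = b3) ->
    \sum_z F z = t%:R * b1 + (q%:R * b2 + t%:R * b3).
  move=> F1 F2 F3; rewrite !big_sumType /=.
  under eq_bigr do rewrite F1; under [X in _ + (X + _)]eq_bigr do rewrite F2.
  under [X in _ + (_ + X)]eq_bigr do rewrite F3.
  by rewrite !sumr_const !card_ord !mulr_natl.
have row x : \sum_z y z * (gdist G z x)%:R <= mu R G * y x + delta.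
  apply: (@le_trans _ _ (\sum_z y z * (1 + far z x)%:R - y x * (1 + far x x)%:R)).
    rewrite (bigD1 x) //= [X in _ <= X - _](bigD1 x) //= gdist_refl mulr0 add0r.
    rewrite [X in _ <= X - _]addrC addrK; apply: ler_sum => z zx.
    apply: ler_wpM2l; first exact: ltW.
    by rewrite ler_nat; have := extremal_gdist_le z x q1 t0; rewrite zx mul1n.
  have -> : mu R G = u - 1 by rewrite uE addrK.
  rewrite /delta; case: x => [i|[j|k]]; rewrite /= ?mulr1 ?addn0.
  - rewrite (sum_y _ (1 - d) 1 c) => [|? /=|? /=|? /=]; rewrite ?addn0 ?mulr1 //.
    lra.
  - rewrite (sum_y _ (1 - d) 1 (c * 2)) => [|? /=|? /=|? /=]; rewrite ?addn0 ?mulr1 //.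
    lra.
  rewrite (sum_y _ (1 - d) 2 (c * 2)) => [|? /=|? /=|? /=]; rewrite ?addn0 ?mulr1 ?mul1r //.
  lra.
(* As [y <= 2] and [delta < 0], [delta] is at most [delta / 2] times [y]. The lowered value is at
   least [u / 2 - 1], hence nonnegative as [mu_le] demands. *)
have : mu R G <= mu R G + delta / 2.
  apply: mu_le y_gt0 _ => [|x].
    have : 0 <= t%:R * (1 - d) by apply: mulr_ge0; lra.
    have : 0 <= t%:R * c by apply: mulr_ge0; lra.
    have : 0 <= q%:R :> R by exact: ler0n.
    by rewrite /delta; lra.
  apply: le_trans (row x) _; rewrite mulrDl lerD2l.
  have : 0 <= - delta * (2 - y x) by apply: mulr_ge0; have := y_le2 x; lra.
  by lra.
by lra.
Qed.

End ExtremalGraph.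

(** * Rayleigh quotients of vectors with three values *)

Section Density.
Local Open Scope ring_scope.
Variables (R : realType) (V : finType) (e h : rel V).
Hypotheses (e_sym : symmetric e) (h_simple : simple_graph h).
Hypothesis eh : subrel e h.

Lemma sum_three (W K : {set V}) (b a : R) : [disjoint W & K] ->
  \sum_x (if x \in W then b else if x \in K then 1 else a)
  = (#|V|%:R - #|W|%:R - #|K|%:R) * a + #|K|%:R + #|W|%:R * b.
Proof.
move=> WK; have WUK : #|W :|: K| = (#|W| + #|K|)%N.
  by rewrite cardsU disjoint_setI0 // cards0 subn0.
have -> : #|V| = (#|W| + #|K| + #|~: (W :|: K)|)%N by rewrite -WUK cardsC.
rewrite (bigID (mem W)) /= (eq_bigr (fun=> b)) => [|x ->//].
rewrite [X in _ + X](bigID (mem K)) /= [X in _ + (X + _)](eq_bigr (fun=> 1)); last first.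
  by move=> x /andP [/negbTE-> ->].
rewrite [X in _ + (_ + X)](eq_bigr (fun=> a)); last first.
  by move=> x /andP [/negbTE-> /negbTE->].
rewrite !sumr_const -[b *+ _]mulr_natl -[a *+ _]mulr_natl.
have -> : #|[pred i | (i \notin W) & i \in K]| = #|K|.
  apply: eq_card => x; rewrite !inE; case xK: (x \in K); rewrite ?andbF //.
  by rewrite (disjointFl WK xK).
have -> : #|[pred i | (i \notin W) & i \notin K]| = #|~: (W :|: K)|.
  by apply: eq_card => x; rewrite !inE negb_or.
by rewrite !natrD; ring.
Qed.

Lemma distance_rayleigh (W K : {set V}) (a c : R) :
    [disjoint W & K] -> 0 <= a -> 0 <= c ->
  let n := #|V|%:R in let k := #|W|%:R in let s := n - k - #|K|%:R in
  (s * a + #|K|%:R + k * c) ^+ 2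
    + (c ^+ 2 * (k * (k - 1) - (\sum_(w in W) deg_in h W w)%:R)
       + 2 * c * (k * #|K|%:R - (\sum_(w in W) deg_in h K w)%:R))
  <= (mu R e + 1) * (s * a ^+ 2 + #|K|%:R + k * c ^+ 2).
Proof.
move=> WK a0 c0; cbv zeta; rewrite -(sum_three c a WK) -(sum_three _ _ WK).
pose f x := if x \in W then c else if x \in K then 1 else a.
have f_ge0 x : 0 <= f x by rewrite /f; case: ifP => // _; case: ifP.
have -> : \sum_x (if x \in W then c ^+ 2 else if x \in K then 1 else a ^+ 2)
    = \sum_x f x ^+ 2.
  apply: eq_bigr => x _; rewrite /f; case: ifP => // _.
  by case: ifP; rewrite ?expr1n.
apply: le_trans (distance_form_ge e_sym eh f_ge0); rewrite lerD2l.
apply: nonadjacent_weight_ge => // x; rewrite /f; first by move=> ->.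
by move=> xK; rewrite xK (disjointFl WK xK).
Qed.

Lemma card_le_mu : (0 < #|V|)%N -> #|V|%:R <= mu R e + 1.
Proof.
move=> V0; have f0 (x : V) : 0 <= 1 :> R by [].
have := distance_form_ge e_sym eh f0; under [in leRHS]eq_bigr do rewrite expr1n.
rewrite sumr_const -mulr_natl mulr1 => le.
have n0 : 0 < #|V|%:R :> R by rewrite ltr0n.
rewrite -(ler_pM2r n0); apply: le_trans le; rewrite -expr2 lerDl.
by do 2!(apply: sumr_ge0 => ? _); rewrite !mulr_ge0.
Qed.

End Density.

(** * From degree bounds to a Hamiltonian path *)

Lemma min_degree_le (V : finType) (e : rel V) v : min_degree e <= deg e v.
Proof.
rewrite /min_degree; have := mem_index_enum v.
elim: (index_enum V) => // w r IHr; rewrite inE big_cons => /orP [/eqP <-|/IHr].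
  exact: geq_minl.
by apply: leq_trans; apply: geq_minr.
Qed.

Lemma deg_sub (V : finType) (e h : rel V) v : subrel e h -> deg e v <= deg h v.
Proof.
by move=> eh; apply: subset_leq_card; apply/fintype.subsetP => w;
  rewrite !inE; apply: eh.
Qed.

Section Counts.
Local Open Scope ring_scope.
Variable R : realFieldType.

(** Here [k] is the size of [W], [p] that of the set of vertices of [C] with a non-neighbour in [W],
    and [s] that of the rest of [C]. *)
Lemma few_counts_lt (t n k p s i e : nat) (u c d : R) :
    (0 < t)%N -> (7 * t + 2 <= n)%N -> (s + p + k = n)%N -> (t < k)%N ->
    (k.*2 < n)%N -> (e <= p * (k - t - 1))%N -> (i + s * k + e <= k * k.-1)%N ->
    n%:R <= u -> 1 <= c <= 2 -> 0 <= d <= 1 -> u * d = t%:R * c ->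
    (u + 1) * c = u + n%:R - 2 * t%:R ->
    0 <= t%:R * (1 - d) + (n%:R - 2 * t%:R) + 2 * (t%:R * c) - u ->
  u * (s%:R * (1 - d) ^+ 2 + p%:R + k%:R * c ^+ 2)
  < (s%:R * (1 - d) + p%:R + k%:R * c) ^+ 2
    + (c ^+ 2 * (k%:R * (k%:R - 1) - i%:R) + 2 * c * (k%:R * p%:R - e%:R)).
Proof.
move=> t0 n_ge nE kt kn e_le ie_le u_ge c12 d01 ud uc delta0.
have pE : p%:R = n%:R - k%:R - s%:R :> R by rewrite -nE !natrD; ring.
have kR : t%:R + 1 <= k%:R :> R by rewrite natr1 ler_nat.
rewrite pE; apply: (@rayleigh_few R _ t%:R) => //; rewrite -?pE ?ler0n //.
- by rewrite ler1n.
- by rewrite -natrM -natrD ler_nat.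
- by rewrite lerBrDr -natrM natr1 ler_nat; lia.
- have -> : k%:R - t%:R - 1 = (k - t - 1)%:R :> R by rewrite !natrB //; lia.
  by rewrite mulrC -natrM ler_nat.
have -> : k%:R - 1 = k.-1%:R :> R by rewrite -subn1 natrB //; lia.
by rewrite -!natrM -!natrD ler_nat.
Qed.

Lemma many_counts_lt (t n k p i e : nat) (u c d : R) :
    (0 < t)%N -> (7 * t + 2 <= n)%N -> (p + k = n)%N -> (n <= k.*2)%N ->
    (e <= k * p)%N -> ((i + e).*2 <= k * (n - 2))%N ->
    n%:R <= u -> 0 <= d -> (u + 1) * c = u + n%:R - 2 * t%:R ->
    0 <= t%:R * (1 - d) + (n%:R - 2 * t%:R) + 2 * (t%:R * c) - u ->
  u * (p%:R + k%:R * (3 / 2) ^+ 2)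
  < (p%:R + k%:R * (3 / 2)) ^+ 2
    + ((3 / 2) ^+ 2 * (k%:R * (k%:R - 1) - i%:R)
       + 2 * (3 / 2) * (k%:R * p%:R - e%:R)).
Proof.
move=> t0 n_ge nE kn e_le ie_le u_ge d0 uc delta0.
have pE : p%:R = n%:R - k%:R :> R by rewrite -nE !natrD; ring.
have u_le : 10 * u <= 13 * n%:R.
  apply: (@radius_le R _ t%:R u c d) => //; first by rewrite ler1n.
  by rewrite -natrM -natrD ler_nat.
rewrite pE; apply: rayleigh_many => //; rewrite -?pE.
- by rewrite ltr0n; lia.
- by rewrite -natrM ler_nat; lia.
- by rewrite -natrM ler_nat.
have : (2 * (i + e))%:R <= (k * (n - 2))%:R :> R by rewrite ler_nat mul2n.
by rewrite !natrM natrD natrB; [lra | lia].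
Qed.

End Counts.

Lemma dense_traceable (R : realType) (t n : nat) (V : finType) (e : rel V) :
    0 < t -> simple_graph e -> #|V| = n -> 7 * t + 2 <= n -> t <= min_degree e ->
    (mu R e <= mu R (graph_join (complete_graph t)
                       (disjoint_union (complete_graph (n - 2 * t))
                          (edgeless_graph t))))%R ->
  traceable e.
Proof.
move=> t0 e_simple card_V n_ge e_deg e_mu; apply: contrapT => nt.
have [q1 t2n] : 1 < n - 2 * t /\ 2 * t <= n by lia.
have [h [h_simple eh h_nt h_sat]] := saturate e_simple nt.
have h_deg v : t <= deg h v.
  by apply: leq_trans e_deg (leq_trans (min_degree_le e v) (deg_sub v eh)).
have [C [C_cl W_deg W_low W_gt C_adj]] :=
  saturated_structure h_simple h_nt h_sat h_deg.
have e_sym : symmetric e by case: e_simple.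
have [h_sym h_irr] := h_simple.
have V0 : 0 < #|V| by rewrite card_V; lia.
set W := ~: C in W_deg W_gt C_adj.
pose K := [set v in C | ~~ [forall w in W, h v w]].
have CW : #|C| + #|W| = n by rewrite -card_V; exact: cardsC.
have deg_WC w : deg h w = deg_in h C w + deg_in h W w by exact: deg_split.
have KC : K \subset C by apply/fintype.subsetP => v; rewrite inE => /andP [].
have deg_KC w : w \in W -> deg_in h C w = #|C :\: K| + deg_in h K w.
  move=> wW; rewrite !deg_inE (bigID (mem K)) /= addnC; congr (_ + _).
    rewrite -sum1_card; apply: eq_big => [v|v]; first by rewrite !inE andbC.
    case/andP => vC; rewrite inE vC /= negbK => /forall_inP /(_ w wW).
    by rewrite h_sym => ->.
  by apply: eq_bigl => v; rewrite andbC; case vK: (v \in K);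
    rewrite //= (fintype.subsetP KC).
have K_deg v : v \in K -> deg_in h W v + t < #|W|.
  rewrite inE => /andP [vC /negP nadj]; have [adj|//] := C_adj v vC.
  by case: nadj; apply/forall_inP => w; rewrite inE; apply: adj.
have CK : #|C :\: K| + #|K| = #|C| by rewrite addnC -(cardsID K C) (finset.setIidPr KC).
pose I := \sum_(w in W) deg_in h W w.
have sum_W (F : V -> nat) b : (forall w, w \in W -> F w <= b) ->
    \sum_(w in W) F w <= #|W| * b.
  by move=> Fb; rewrite -sum_nat_const; apply: leq_sum.
(* The degree bound [#|W|.-1] is summed over [W], with neighbours split into [W], [C :\: K] and
   [K]. *)
have few_edges : I + #|C :\: K| * #|W| + \sum_(w in W) deg_in h K w
    <= #|W| * #|W|.-1.
  rewrite mulnC -sum_nat_const -!big_split; apply: sum_W => w wW /=.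
  apply: leq_trans (W_deg w _); last by rewrite inE in wW.
  by rewrite deg_WC deg_KC //; lia.
(* Double counting: each vertex of [K] has at most [#|W| - t - 1] neighbours in [W]. *)
have K_edges : \sum_(w in W) deg_in h K w <= #|K| * (#|W| - t - 1).
  rewrite sum_deg_in // -sum_nat_const; apply: leq_sum => v vK.
  by have := K_deg v vK; lia.
have many_edges : (I + \sum_(w in W) deg_in h C w).*2 <= #|W| * (n - 2).
  rewrite -big_split /= -mul2n big_distrr /=; apply: sum_W => w wW.
  rewrite mul2n -card_V; apply: leq_trans (W_low w _); last by rewrite inE in wW.
  by rewrite deg_WC addnC.
have C_edges : \sum_(w in W) deg_in h C w <= #|W| * #|C|.
  by apply: sum_W => w _; apply: subset_leq_card; apply/fintype.subsetP => v;
    rewrite inE => /andP [].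
have WK : [disjoint W & K].
  by rewrite disjoint_sym disjoint_subset; apply/fintype.subsetP => v /(fintype.subsetP KC);
    rewrite !inE negbK.
have WC : [disjoint W & C].
  by rewrite disjoint_sym disjoint_subset; apply/fintype.subsetP => v; rewrite !inE negbK.
move: e_mu (@extremal_delta_ge0 R t (n - 2 * t)); set mu' := mu R (graph_join _ _).
move=> e_mu delta.
have n_le := card_le_mu R e_sym eh V0; rewrite card_V in n_le.
have few := @distance_rayleigh R V e h e_sym h_simple eh W K _ _ WK.
have many := @distance_rayleigh R V e h e_sym h_simple eh W C _ _ WC.
rewrite -/I card_V in few many.
have u_ge : (n%:R <= mu' + 1)%R by apply: le_trans n_le _; rewrite lerD2r.
have t1 : (1 <= t%:R :> R)%R by rewrite ler1n.
have n_geR : (7 * t%:R + 2 <= n%:R :> R)%R by rewrite -natrM -natrD ler_nat.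
have qE : ((n - 2 * t)%:R = n%:R - 2 * t%:R :> R)%R.
  by rewrite natrB ?natrM.
have [c [d [c12 d01 ud uc]]] := test_weights t1 n_geR u_ge.
have /andP [d0 d1] := d01; have /andP [c1 c2] := c12.
have c_gt0 : (0 < c)%R by apply: lt_le_trans c1.
have {}delta : (0 <= t%:R * (1 - d) + (n%:R - 2 * t%:R) + 2 * (t%:R * c) - (mu' + 1))%R.
  have n2 : (2 <= n%:R :> R)%R by rewrite ler_nat; apply: leq_trans n_ge; rewrite leq_addl.
  have t2 : (2 * t%:R < n%:R :> R)%R by rewrite -natrM ltr_nat -subn_gt0 ltnW.
  rewrite -qE; apply: (delta (mu' + 1)%R c d); rewrite ?qE ?addrA ?c_gt0 //.
    exact: lt_le_trans u_ge.
  exact: le_trans u_ge.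
(* The spectral hypothesis enters here; it puts the Rayleigh bounds in conflict with [lt_many] and
   [lt_few]. *)
have scale (b : R) : (0 <= b -> (mu R e + 1) * b <= (mu' + 1) * b)%R.
  by move=> b0; apply: ler_wpM2r; rewrite ?lerD2r.
case: (leqP n #|W|.*2) => kn.
  have lt_many := many_counts_lt t0 n_ge CW kn C_edges many_edges u_ge d0 uc delta.
  have CE : (n%:R - #|W|%:R - #|C|%:R = 0 :> R)%R by rewrite -CW natrD; ring.
  have half3_ge0 : (0 <= 3 / 2 :> R)%R by rewrite divr_ge0 ?ler0n.
  (* With [C] in the place of [K] the third class is empty, so the value [0] on it is an arbitrary
     choice. *)
  have := many 0%R (3 / 2)%R (lexx _) half3_ge0; cbv zeta.
  rewrite CE !mul0r !add0r leNgt => /negP; apply.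
  apply: le_lt_trans lt_many; apply: scale.
  by rewrite addr_ge0 ?ler0n // mulr_ge0 ?ler0n // exprn_ge0.
have nE : #|C :\: K| + #|K| + #|W| = n by rewrite CK.
have lt_few := few_counts_lt t0 n_ge nE W_gt kn K_edges few_edges u_ge c12 d01 ud uc delta.
have sE : (n%:R - #|W|%:R - #|K|%:R = #|C :\: K|%:R :> R)%R.
  by rewrite -nE !natrD; ring.
have d1' : (0 <= 1 - d)%R by rewrite subr_ge0.
have := few (1 - d)%R c d1' (ltW c_gt0); cbv zeta.
rewrite sE leNgt => /negP; apply.
apply: le_lt_trans lt_few; apply: scale.
by rewrite !addr_ge0 ?ler0n // mulr_ge0 ?ler0n // exprn_ge0 // ltW.
Qed.

Theorem theorem1p4 (R : realType) (t n : nat) (V : finType) (e : rel V)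
  (t_gt0 : 0 < t)
  (e_simple : simple_graph e)
  (e_connected : connected_graph e)
  (card_V : #|V| = n)
  (n_ge : 7 * t + 2 <= n)
  (e_deg : t <= min_degree e)
  (e_mu : (mu R e <=
           mu R (graph_join (complete_graph t)
                   (disjoint_union (complete_graph (n - 2 * t))
                      (edgeless_graph t))))%R) :
  exists f : rel V, spanning_tree e f /\ 4 <= leaf_distance f.
Proof.
have [s [e_s s_uniq s_all]] := dense_traceable t_gt0 e_simple card_V n_ge e_deg e_mu.
have V_gt4 : 4 < #|V| by rewrite card_V; lia.
case: s e_s s_uniq s_all => [_ _ s_all|x p /= ep p_uniq p_all].
  by have /card_gt0P [v _] : 0 < #|V| by [lia]; have := s_all v.
exact: (hamiltonian_path_spanning_tree e_simple ep p_uniq p_all V_gt4).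
Qed.
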